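(* There is an absolute constant $C>0$ such that the following holds. Let $G$ be a general two-prover game on a bi-regular bipartite graph $((X,Y),E)$, and let $\epsilon,\delta>0$. Let $H_1=((W,X),E_1)$ and $H_2=((Z,Y),E_2)$ be left-regular bipartite graphs that are both $(\delta,\epsilon,\epsilon)$-fortifiers. Then the concatenated game $G^*=H_1\circ G\circ H_2$ is $(\delta,C\epsilon)$-robust.
   Context: A (general) two-prover game is given by a bipartite (multi)graph $((X,Y),E)$, alphabets $\Sigma_X,\Sigma_Y$, and for each edge $e=(x,y)$ a constraint $\psi_e\subseteq\Sigma_X\times\Sigma_Y$. Its value $\mathrm{val}(G)$ is the maximum, over labellings $L_X:X\to\Sigma_X$, $L_Y:Y\to\Sigma_Y$, of the fraction of edges $(x,y)$ (counted with multiplicity, i.e. a uniformly random edge) with $(L_X(x),L_Y(y))\in\psi_{(x,y)}$. For $S\subseteq X$, $T\subseteq Y$, $G_{S\times T}$ is the game in which the verifier picks a uniformly random edge $(x,y)\in E$ conditioned on $x\in S$, $y\in T$ (i.e. the game restricted to the edges between $S$ and $T$). $G$ is $(\delta,\epsilon)$-robust if for all $S\subseteq X$, $T\subseteq Y$ with $|S|\ge\delta|X|$ and $|T|\ge\delta|Y|$, $\mathrm{val}(G_{S\times T})\le\mathrm{val}(G)+\epsilon$. Concatenation: if $H_1=((W,X),E_1)$ has left-degree $D_1$ and $H_2=((Z,Y),E_2)$ has left-degree $D_2$, the game $H_1\circ G\circ H_2$ is played on a bipartite multigraph on $(W,Z)$ with alphabets $\Sigma_W=\Sigma_X^{D_1}$,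 $\Sigma_Z=\Sigma_Y^{D_2}$; a label of $w\in W$ is viewed as an assignment of labels in $\Sigma_X$ to the $D_1$ neighbours of $w$ in $H_1$ (in a fixed order), and similarly for $z\in Z$. For every $(w,x)\in E_1$, $(x,y)\in E$, $(z,y)\in E_2$ there is an edge $(w,z)$ whose constraint reads off the label of $x$ from the label of $w$ and the label of $y$ from the label of $z$ and checks $\psi_{(x,y)}$. Fortifier: a bipartite graph $H=((W,X),E_H)$ is a $(\delta,\epsilon_1,\epsilon_2)$-fortifier if for every $S\subseteq W$ with $|S|\ge\delta|W|$, the distribution $\pi$ on $X$ obtained by choosing $w\in S$ uniformly and then a uniformly random neighbour $x$ of $w$ satisfies $\sum_{x}|\pi(x)-1/|X||\le\epsilon_1$ and $\sum_x(\pi(x)-1/|X|)^2\le\epsilon_2/|X|$. *)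

(* Defs.v *)
From HB Require Import structures.
From mathcomp Require Import all_boot all_order all_algebra.
From mathcomp Require Import reals.

Set Implicit Arguments.
Unset Strict Implicit.
Unset Printing Implicit Defensive.

Import Order.TTheory GRing.Theory Num.Theory.
Local Open Scope ring_scope.

(* The edges form a type of their own, so that parallel edges, possibly with
   different constraints, are allowed. *)
Record game (X Y A B : finType) := Game {
  edge : finType;
  left_end : edge -> X;
  right_end : edge -> Y;
  constraint : edge -> {set A * B}
}.

Section Games.
Variables (R : realType) (X Y A B : finType).
Implicit Type G : game X Y A B.

Definition satisfied G (L : {ffun X -> A} * {ffun Y -> B}) : {set edge G} :=
  [set e | (L.1 (left_end e), L.2 (right_end e)) \in constraint e].

(* A game without edges has value 0. *)
Definition game_val G : R :=
  \big[Num.max/0]_(L : {ffun X -> A} * {ffun Y -> B})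
    (#|satisfied G L|%:R / #|edge G|%:R).

Definition restrict G (S : {set X}) (T : {set Y}) : game X Y A B :=
  @Game X Y A B {e : edge G | (left_end e \in S) && (right_end e \in T)}
    (fun e => left_end (sval e)) (fun e => right_end (sval e))
    (fun e => constraint (sval e)).

Definition robust (delta eps : R) G : Prop :=
  forall (S : {set X}) (T : {set Y}),
    delta * #|X|%:R <= #|S|%:R -> delta * #|Y|%:R <= #|T|%:R ->
    game_val (restrict G S T) <= game_val G + eps.

Definition biregular G : Prop :=
  exists dX dY : nat,
    (forall x : X, #|[set e : edge G | left_end e == x]| = dX) /\
    (forall y : Y, #|[set e : edge G | right_end e == y]| = dY).

End Games.

Section BipartiteGraphs.
Variables (R : realType) (W X : finType).
Implicit Type H : {set W * X}.

Definition nbrs H (w : W) : {set X} := [set x | (w, x) \in H].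

Definition left_regular H (D : nat) : Prop := forall w : W, #|nbrs H w| = D.

Definition nbr_dist H (S : {set W}) (x : X) : R :=
  \sum_(w in S) #|S|%:R^-1 * (if x \in nbrs H w then #|nbrs H w|%:R^-1 else 0).

Definition fortifier (delta eps1 eps2 : R) H : Prop :=
  forall S : {set W}, delta * #|W|%:R <= #|S|%:R ->
    \sum_(x : X) `|nbr_dist H S x - #|X|%:R^-1| <= eps1 /\
    \sum_(x : X) (nbr_dist H S x - #|X|%:R^-1) ^+ 2 <= eps2 / #|X|%:R.

(* The position of x among the D neighbours of w, listed in the order of
   enum X. *)
Definition nbr_index H D (regH : left_regular H D) (w : W) (x : X)
    (wx : (w, x) \in H) : 'I_D :=
  cast_ord (regH w) (enum_rank_in (etrans (in_set _ x) wx : x \in nbrs H w) x).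

End BipartiteGraphs.

Section Concatenation.
Variables (X Y A B W Z : finType).

(* (w, x) and (z, y) are determined by w, z and the edge e = (x, y) of G, so
   the edges of the concatenated game are triples (w, e, z). *)
Definition concat_edge (G : game X Y A B) (H1 : {set W * X}) (H2 : {set Z * Y})
    : finType :=
  {t : W * edge G * Z |
    ((t.1.1, left_end t.1.2) \in H1) && ((t.2, right_end t.1.2) \in H2)}.

Definition concat (G : game X Y A B) (H1 : {set W * X}) (H2 : {set Z * Y})
    (D1 D2 : nat) (reg1 : left_regular H1 D1) (reg2 : left_regular H2 D2) :
    game W Z (D1.-tuple A) (D2.-tuple B) :=
  @Game W Z (D1.-tuple A) (D2.-tuple B) (concat_edge G H1 H2)
    (fun t => (sval t).1.1) (fun t => (sval t).2)
    (fun t =>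
      let i := nbr_index reg1 (proj1 (andP (svalP t))) in
      let j := nbr_index reg2 (proj2 (andP (svalP t))) in
      [set ab | (tnth ab.1 i, tnth ab.2 j) \in constraint (sval t).1.2]).

End Concatenation.

(* Main.v *)
Require Import Defs.
From mathcomp Require Import all_boot all_order all_algebra.
From mathcomp Require Import reals ring lra.

Set Implicit Arguments.
Unset Strict Implicit.
Unset Printing Implicit Defensive.

Import Order.TTheory GRing.Theory Num.Theory.
Local Open Scope ring_scope.

(** Restricting the concatenated game to [S] and [T] weights an edge [(x, y)] of
    [G] proportionally to [pi(x) rho(y)], where [pi] and [rho] are the neighbour
    distributions of [S] and [T].  Writing [|X| pi = 1 + alpha] and
    [|Y| rho = 1 + beta], the weight [(1 + alpha)(1 + beta)] is within [3 eps] of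
    uniform on average: biregularity transports the [L1] bounds to the edges, and
    AM-GM with the [L2] bounds controls the product [alpha beta].  Hence the value
    of any strategy changes by at most [3 eps] when the edge distribution is made
    uniform.  Labels of the restricted game give a mixed strategy for [G] (each
    [x] asks a random neighbour in [S]), which some pure strategy matches, and
    labels of [G] lift to the concatenated game; so both values are within
    [3 eps] of the value of [G], and [C = 6] works. *)

(** * Preliminaries on finite averages *)

(** Centring [s] at its weighted mean [r] absorbs the normalisation of [mu]: as [s i] and [r] lie in
    [0, 1], only the factor [mu i - 1] costs anything, and no constant is lost. *)
Lemma weighted_mean_close (R : realFieldType) (I : finType) (mu s : I -> R)
    (c : R) :
  (forall i, 0 <= mu i) -> (forall i, 0 <= s i <= 1) ->
  0 < \sum_i mu i -> \sum_i `|mu i - 1| <= c * #|I|%:R ->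
  `|(\sum_i mu i * s i) / (\sum_i mu i) - (\sum_i s i) / #|I|%:R| <= c.
Proof.
move=> mu0 s01 M0 muc; set M := \sum_i mu i; set r := _ / M.
have I0 : 0 < #|I|%:R :> R.
  rewrite ltr0n lt0n; apply/negP => /eqP I0; move: M0.
  by rewrite big_pred0 ?ltxx // => i; have := card0_eq I0 i.
have r01 : 0 <= r <= 1.
  rewrite divr_ge0 ?(ltW M0) ?sumr_ge0 //=; last first.
    by move=> i _; rewrite mulr_ge0 //; case/andP: (s01 i).
  rewrite ler_pdivrMr // mul1r ler_sum // => i _.
  by rewrite ler_piMr //; case/andP: (s01 i).
(* The [mu]-weighted deviations from the mean [r] cancel. *)
have -> : r - (\sum_i s i) / #|I|%:R =
          (\sum_i (mu i - 1) * (s i - r)) / #|I|%:R.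
  have -> : \sum_i (mu i - 1) * (s i - r) =
      (\sum_i mu i * s i) - r * M - (\sum_i s i - r * #|I|%:R).
    have -> : r * #|I|%:R = \sum_(i : I) r by rewrite sumr_const mulr_natr.
    rewrite mulr_sumr -!sumrB; apply: eq_bigr => i _; ring.
  have -> : r * M = \sum_i mu i * s i by rewrite divfK // gt_eqF.
  by rewrite subrr sub0r opprB mulrBl mulfK // gt_eqF.
rewrite normrM normfV (gtr0_norm I0) ler_pdivrMr //; apply: le_trans muc.
apply: le_trans (ler_norm_sum _ _ _) _; apply: ler_sum => i _.
rewrite normrM ler_piMr // ler_norml.
by move: (s01 i) r01 => /andP[? ?] /andP[? ?]; lra.
Qed.

(** Regularity enters the argument here: an end of a uniform edge is a uniform vertex. *)
Lemma sum_regular_fibres (R : pzSemiRingType) (E X : finType) (f : E -> X)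
    (d : nat) (F : X -> R) :
  (forall x, #|[set e | f e == x]| = d) ->
  \sum_e F (f e) = d%:R * \sum_x F x.
Proof.
move=> fd; rewrite (partition_big f predT) //= mulr_sumr.
apply: eq_bigr => x _; rewrite -(fd x) cardsE mulr_natl -sumr_const.
by apply: eq_big => // e /eqP->.
Qed.

(** The two ends of an edge are correlated, so the product of the deviations does not factor; it is
    bounded edge by edge by half the sum of their squares. The terms alpha, beta and alpha beta cost
    [eps] each. *)
Lemma biregular_density_close (R : realFieldType) (X Y E : finType)
    (f : E -> X) (g : E -> Y) (dX dY : nat) (a : X -> R) (b : Y -> R)
    (eps : R) :
  (forall x, #|[set e | f e == x]| = dX) ->
  (forall y, #|[set e | g e == y]| = dY) ->
  \sum_x `|a x - #|X|%:R^-1| <= eps ->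
  \sum_x (a x - #|X|%:R^-1) ^+ 2 <= eps / #|X|%:R ->
  \sum_y `|b y - #|Y|%:R^-1| <= eps ->
  \sum_y (b y - #|Y|%:R^-1) ^+ 2 <= eps / #|Y|%:R ->
  \sum_e `|#|X|%:R * a (f e) * (#|Y|%:R * b (g e)) - 1| <= 3 * eps * #|E|%:R.
Proof.
(* One argument for both sides. For the squares, the scaling by |V|^2, the bound eps/|V| and the
   fibre size d multiply to eps |E|. *)
have fibre (V : finType) (h : E -> V) d (c : V -> R) :
    (forall v, #|[set e | h e == v]| = d) ->
    \sum_v `|c v - #|V|%:R^-1| <= eps ->
    \sum_v (c v - #|V|%:R^-1) ^+ 2 <= eps / #|V|%:R ->
    \sum_e `|#|V|%:R * c (h e) - 1| <= eps * #|E|%:R /\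
    \sum_e (#|V|%:R * c (h e) - 1) ^+ 2 <= eps * #|E|%:R.
  move=> hd c1 c2.
  have cardE : #|E|%:R = d%:R * #|V|%:R :> R.
    have := sum_regular_fibres (fun=> 1 : R) hd.
    by rewrite !sumr_const.
  have [V0|V0] := posnP #|V|.
    rewrite cardE V0 mulr0 mulr0.
    have E0 (e : E) : False by have := card0_eq V0 (h e).
    by rewrite !big1 // => e; case: (E0 e).
  have nV0 : #|V|%:R != 0 :> R by rewrite pnatr_eq0 -lt0n.
  have dev v : #|V|%:R * c v - 1 = #|V|%:R * (c v - #|V|%:R^-1).
    by rewrite mulrBr divff.
  rewrite (sum_regular_fibres (fun v => `|#|V|%:R * c v - 1|) hd).
  rewrite (sum_regular_fibres (fun v => (#|V|%:R * c v - 1) ^+ 2) hd).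
  split; rewrite cardE mulrCA ler_wpM2l //.
    under eq_bigr do rewrite dev normrM normr_nat.
    by rewrite -mulr_sumr mulrC ler_wpM2r.
  under eq_bigr do rewrite dev exprMn.
  by rewrite -mulr_sumr expr2 -mulrA mulrC ler_wpM2r // -ler_pdivlMl ?ltr0n //
    mulrC.
move=> fX gY a1 a2 b1 b2.
have [A1 A2] := fibre _ _ _ _ fX a1 a2.
have [B1 B2] := fibre _ _ _ _ gY b1 b2.
pose al e := #|X|%:R * a (f e) - 1; pose be e := #|Y|%:R * b (g e) - 1.
apply: (@le_trans _ _
  (\sum_e (`|al e| + `|be e| + (al e ^+ 2 + be e ^+ 2) / 2))); last first.
  rewrite !big_split /= -mulr_suml big_split /=.
  move: A1 A2 B1 B2; rewrite -/(al _) -/(be _); lra.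
apply: ler_sum => e _.
have -> : #|X|%:R * a (f e) * (#|Y|%:R * b (g e)) - 1 =
          al e + be e + al e * be e by rewrite /al /be; ring.
apply: le_trans (ler_normD _ _) _; apply: lerD; first exact: ler_normD.
have := sqr_ge0 (`|al e| - `|be e|).
by rewrite sqrrB !real_normK ?num_real // normrM -mulr_natr; lra.
Qed.

(* Against a fixed linear payoff a subdistribution never beats its best pure
   choice. *)
Lemma pure_choice (R : realFieldType) (X I : finType) (i0 : I)
    (p F : X -> I -> R) :
  (forall x i, 0 <= p x i) -> (forall x, \sum_i p x i <= 1) ->
  (forall x i, 0 <= F x i) ->
  exists c : X -> I, \sum_x \sum_i p x i * F x i <= \sum_x F x (c x).
Proof.
move=> p0 p1 F0; exists (fun x => [arg max_(i > i0) F x i]%O).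
apply: ler_sum => x _; case: arg_maxP => // j _ jmax.
apply: (@le_trans _ _ (\sum_i p x i * F x j)).
  by apply: ler_sum => i _; rewrite ler_wpM2l //; apply: jmax.
by rewrite -mulr_suml ler_piMl.
Qed.

(** * Game values and mixed strategies *)

Lemma game_val_ge (R : realType) (X Y A B : finType) (G : game X Y A B) L :
  #|satisfied G L|%:R / #|edge G|%:R <= game_val R G.
Proof. exact: le_bigmax. Qed.

Lemma game_val_ge0 (R : realType) (X Y A B : finType) (G : game X Y A B) :
  0 <= game_val R G.
Proof. exact: bigmax_ge_id. Qed.

Lemma card_satisfied (X Y A B : finType) (G : game X Y A B) L :
  #|satisfied G L| =
  (\sum_(e : edge G)
    ((L.1 (left_end e), L.2 (right_end e)) \in constraint e))%N.
Proof.
rewrite -sum1_card big_mkcond; apply: eq_bigr => e _.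
by rewrite inE; case: ifP.
Qed.

(** The payoff is bilinear in [p] and [q], so it is derandomised one side at a time: first a best
    [w] for each [x] against [q], then a best [z] for each [y] against that choice. *)
Lemma mixed_strategy_le (R : realType) (X Y A B W Z : finType)
    (G : game X Y A B) (w0 : W) (z0 : Z) (p : X -> W -> R) (q : Y -> Z -> R)
    (l : W -> X -> A) (m : Z -> Y -> B) :
  (forall x w, 0 <= p x w) -> (forall x, \sum_w p x w <= 1) ->
  (forall y z, 0 <= q y z) -> (forall y, \sum_z q y z <= 1) ->
  \sum_(e : edge G) \sum_w \sum_z p (left_end e) w * q (right_end e) z *
    ((l w (left_end e), m z (right_end e)) \in constraint e)%:R
  <= #|edge G|%:R * game_val R G.
Proof.
move=> p0 p1 q0 q1.
pose pay (e : edge G) w z : R :=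
  ((l w (left_end e), m z (right_end e)) \in constraint e)%:R.
have pay0 e w z : 0 <= pay e w z by exact: ler0n.
(* Once edges are grouped by an end, the choices at different vertices are independent. *)
have group (V : finType) (h : edge G -> V) (F : V -> edge G -> R) :
    \sum_e F (h e) e = \sum_v \sum_(e | h e == v) F v e.
  rewrite (partition_big h predT) //=; apply: eq_bigr => v _.
  by apply: eq_bigr => e /eqP->.
have [c cP] := pure_choice w0
  (F := fun x w => \sum_(e | left_end e == x) \sum_z q (right_end e) z * pay e w z)
  p0 p1 (fun x w => sumr_ge0 _ (fun e _ =>
    sumr_ge0 _ (fun z _ => mulr_ge0 (q0 _ _) (pay0 _ _ _)))).
have [d dP] := pure_choice z0
  (F := fun y z => \sum_(e | right_end e == y) pay e (c (left_end e)) z)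
  q0 q1 (fun y z => sumr_ge0 _ (fun e _ => pay0 _ _ _)).
pose L : {ffun X -> A} * {ffun Y -> B} :=
  ([ffun x => l (c x) x], [ffun y => m (d y) y]).
have valL : #|satisfied G L|%:R <= #|edge G|%:R * game_val R G.
  have [E0|E0] := posnP #|edge G|.
    by rewrite E0 mul0r lern0 -leqn0 -E0 max_card.
  by rewrite mulrC -ler_pdivrMr ?ltr0n // game_val_ge.
apply: le_trans valL; rewrite card_satisfied natr_sum.
apply: (@le_trans _ _ (\sum_x \sum_w p x w *
    (\sum_(e | left_end e == x) \sum_z q (right_end e) z * pay e w z))).
  rewrite (group _ (@left_end _ _ _ _ G) (fun x e => \sum_w \sum_z
    p x w * q (right_end e) z * pay e w z)).
  apply: ler_sum => x _; rewrite exchange_big /=; apply: ler_sum => w _.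
  rewrite mulr_sumr; apply: ler_sum => e _; rewrite mulr_sumr.
  by apply: ler_sum => z _; rewrite mulrA.
apply: (le_trans cP).
rewrite -(group _ (@left_end _ _ _ _ G) (fun x e => \sum_z
  q (right_end e) z * pay e (c x) z)).
apply: (@le_trans _ _ (\sum_y \sum_z q y z *
    (\sum_(e | right_end e == y) pay e (c (left_end e)) z))).
  rewrite (group _ (@right_end _ _ _ _ G) (fun y e => \sum_z
    q y z * pay e (c (left_end e)) z)).
  apply: ler_sum => y _; rewrite exchange_big /=; apply: ler_sum => z _.
  by rewrite mulr_sumr.
apply: (le_trans dP).
rewrite -(group _ (@right_end _ _ _ _ G) (fun y e => pay e (c (left_end e)) (d y))).
by apply: ler_sum => e _; rewrite /pay !ffunE.
Qed.

(** * Restricted games *)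

Lemma game_val_no_edge (R : realType) (X Y A B : finType) (G : game X Y A B) :
  #|edge G| = 0%N -> game_val R G = 0.
Proof.
move=> E0; apply/eqP; rewrite eq_le game_val_ge0 andbT; apply: bigmax_le => // L _.
by rewrite E0 invr0 mulr0.
Qed.

Lemma card_edge_restrict (X Y A B : finType) (G : game X Y A B) S T :
  #|edge (restrict G S T)| =
  (\sum_(e : edge G | (left_end e \in S) && (right_end e \in T)) 1)%N.
Proof. by rewrite card_sig sum1_card. Qed.

Lemma card_satisfied_restrict (X Y A B : finType) (G : game X Y A B) S T L :
  #|satisfied (restrict G S T) L| =
  (\sum_(e : edge G | (left_end e \in S) && (right_end e \in T))
    ((L.1 (left_end e), L.2 (right_end e)) \in constraint e))%N.
Proof.
rewrite card_satisfied; symmetry.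
exact: (big_sub (fun e => (left_end e \in S) && (right_end e \in T))
  (fun e => (L.1 (left_end e), L.2 (right_end e)) \in constraint e : nat)).
Qed.

(** Lets the whole concatenated game be treated as one of its restrictions. *)
Lemma game_val_restrict_setT (R : realType) (X Y A B : finType)
    (G : game X Y A B) :
  game_val R (restrict G [set: X] [set: Y]) = game_val R G.
Proof.
apply: eq_bigr => L _; rewrite card_satisfied_restrict card_satisfied.
rewrite card_edge_restrict -sum1_card; congr (_%:R / _%:R);
  by apply: eq_bigl => e; rewrite !in_setT.
Qed.

(** * Neighbour counts and fortified averages *)

Definition back_nbrs (W X : finType) (H : {set W * X}) (S : {set W}) (x : X) :
  {set W} := [set w in S | (w, x) \in H].

(** By left-regularity, a uniform vertex of [S] with a uniform neighbour is a uniform edge among the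
    |S| D edges leaving [S]. *)
Lemma nbr_distE (R : realType) (W X : finType) (H : {set W * X}) (D : nat)
    (S : {set W}) (x : X) :
  left_regular H D ->
  nbr_dist R H S x = #|back_nbrs H S x|%:R / (#|S| * D)%:R.
Proof.
move=> regH; rewrite /nbr_dist natrM invfM mulrCA -mulr_sumr; congr (_ * _).
rewrite mulr_natl -sumr_const big_mkcond [RHS]big_mkcond /=.
by apply: eq_bigr => w _; rewrite !inE regH; case: (w \in S).
Qed.

Lemma back_nbrs_gt0 (W X : finType) (H : {set W * X}) (D : nat)
    (S : {set W}) (x : X) :
  left_regular H D -> (0 < #|back_nbrs H S x| -> 0 < #|S| * D)%N.
Proof.
move=> regH /card_gt0P[w]; rewrite inE => /andP[wS wx].
rewrite muln_gt0 -(regH w); apply/andP; split; apply/card_gt0P; first by exists w.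
by exists x; rewrite inE.
Qed.

(** [n e] is the number of copies of [e] in the restricted concatenated game. Up to a factor it is
    the product of the two neighbour distributions, to which the density bound applies. *)
Lemma fortified_mean_close (R : realType) (X Y A B W Z : finType)
    (G : game X Y A B) (eps delta : R) (H1 : {set W * X}) (H2 : {set Z * Y})
    (D1 D2 : nat) (S : {set W}) (T : {set Z}) (s : edge G -> R) :
  left_regular H1 D1 -> left_regular H2 D2 -> biregular G ->
  fortifier delta eps eps H1 -> fortifier delta eps eps H2 ->
  delta * #|W|%:R <= #|S|%:R -> delta * #|Z|%:R <= #|T|%:R ->
  (forall e, 0 <= s e <= 1) ->
  let n e := (#|back_nbrs H1 S (left_end e)| *
              #|back_nbrs H2 T (right_end e)|)%:R in
  0 < \sum_e n e ->
  `|(\sum_e n e * s e) / (\sum_e n e) - (\sum_e s e) / #|edge G|%:R| <= 3 * eps.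
Proof.
move=> reg1 reg2 [dX [dY [fX gY]]] fort1 fort2 Sbig Tbig s01 n n0.
(* One edge with a copy makes all the normalisers below nonzero. *)
have [e] : exists e, 0 < n e.
  apply/existsP; apply: contraLR n0; rewrite negb_exists -leNgt => /forallP n0.
  by apply: sumr_le0 => e _; rewrite leNgt.
rewrite ltr0n muln_gt0 => /andP[n1 n2].
have [a1 a2] := fort1 S Sbig; have [b1 b2] := fort2 T Tbig.
have k1 := back_nbrs_gt0 reg1 n1; have k2 := back_nbrs_gt0 reg2 n2.
have X0 : (0 < #|X|)%N by apply/card_gt0P; exists (left_end e).
have Y0 : (0 < #|Y|)%N by apply/card_gt0P; exists (right_end e).
(* The factor turning [n] into the density relative to uniform; it cancels in the weighted mean. *)
pose k : R := #|X|%:R / (#|S| * D1)%:R * (#|Y|%:R / (#|T| * D2)%:R).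
have k0 : 0 < k by rewrite mulr_gt0 // divr_gt0 ?ltr0n.
pose mu e := k * n e.
have muE e' : mu e' = #|X|%:R * nbr_dist R H1 S (left_end e') *
    (#|Y|%:R * nbr_dist R H2 T (right_end e')).
  rewrite (nbr_distE _ _ _ reg1) (nbr_distE _ _ _ reg2) /mu /n natrM /k; ring.
have := biregular_density_close fX gY a1 a2 b1 b2.
under eq_bigr do rewrite -muE.
have sum_mu : \sum_e mu e = k * \sum_e n e by rewrite mulr_sumr.
have sum_mus : \sum_e mu e * s e = k * \sum_e n e * s e.
  by rewrite mulr_sumr; apply: eq_bigr => e' _; rewrite mulrA.
move=> muc; have := weighted_mean_close _ s01 _ muc.
rewrite sum_mus sum_mu -mulf_div divff ?gt_eqF // mul1r; apply.
  by move=> e'; rewrite mulr_ge0 ?ler0n // ltW.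
by rewrite mulr_gt0.
Qed.

(** * Counting edges of the restricted concatenation *)

Lemma sum_concat_edge (X Y A B W Z : finType) (G : game X Y A B)
    (H1 : {set W * X}) (H2 : {set Z * Y}) (S : {set W}) (T : {set Z})
    (F : W * edge G * Z -> nat) :
  (\sum_(t : concat_edge G H1 H2 |
      ((sval t).1.1 \in S) && ((sval t).2 \in T)) F (sval t) =
   \sum_(e : edge G) \sum_(w in back_nbrs H1 S (left_end e))
     \sum_(z in back_nbrs H2 T (right_end e)) F (w, e, z))%N.
Proof.
transitivity (\sum_(t : W * edge G * Z |
    ((t.1.1, left_end t.1.2) \in H1) && ((t.2, right_end t.1.2) \in H2) &&
    ((t.1.1 \in S) && (t.2 \in T))) F t)%N.
  symmetry; exact: (big_sub_cond (fun t : W * edge G * Z =>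
    ((t.1.1, left_end t.1.2) \in H1) && ((t.2, right_end t.1.2) \in H2))
    (fun t => (t.1.1 \in S) && (t.2 \in T)) F).
have sum3 (f : W * edge G * Z -> nat) :
    (\sum_t f t = \sum_e \sum_w \sum_z f (w, e, z))%N.
  by rewrite exchange_big !pair_bigA; apply: eq_bigr => -[[w e] z].
rewrite big_mkcond sum3; apply: eq_bigr => e _.
rewrite [RHS]big_mkcond; apply: eq_bigr => w _.
rewrite [in RHS]inE; case: ifP => [/andP[wS wx]|wU].
  rewrite [RHS]big_mkcond; apply: eq_bigr => z _.
  by rewrite !inE /= wS wx /= andbC.
rewrite big1 // => z _; case: ifP => //.
by move=> /= /andP[/andP[wx _] /andP[wS _]]; rewrite wS wx in wU.
Qed.

Lemma card_edge_restrict_concat (X Y A B W Z : finType) (G : game X Y A B)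
    (H1 : {set W * X}) (H2 : {set Z * Y}) (D1 D2 : nat)
    (reg1 : left_regular H1 D1) (reg2 : left_regular H2 D2) S T :
  #|edge (restrict (concat G reg1 reg2) S T)| =
  (\sum_(e : edge G) #|back_nbrs H1 S (left_end e)| *
                     #|back_nbrs H2 T (right_end e)|)%N.
Proof.
rewrite card_edge_restrict.
rewrite (sum_concat_edge H1 H2 S T (fun _ : W * edge G * Z => 1%N)).
by apply: eq_bigr => e _; rewrite !sum_nat_const muln1.
Qed.

(** Replacing tuples by plain functions [l] and [m] removes the positions, which depend on
    membership proofs, so that the count can be regrouped by edges of [G]. *)
Lemma card_satisfied_restrict_concat (X Y A B W Z : finType)
    (G : game X Y A B) (H1 : {set W * X}) (H2 : {set Z * Y}) (D1 D2 : nat)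
    (reg1 : left_regular H1 D1) (reg2 : left_regular H2 D2) S T
    (L : {ffun W -> D1.-tuple A} * {ffun Z -> D2.-tuple B})
    (l : W -> X -> A) (m : Z -> Y -> B) :
  (forall w x (wx : (w, x) \in H1),
    tnth (L.1 w) (nbr_index reg1 wx) = l w x) ->
  (forall z y (zy : (z, y) \in H2),
    tnth (L.2 z) (nbr_index reg2 zy) = m z y) ->
  #|satisfied (restrict (concat G reg1 reg2) S T) L| =
  (\sum_(e : edge G) \sum_(w in back_nbrs H1 S (left_end e))
     \sum_(z in back_nbrs H2 T (right_end e))
       ((l w (left_end e), m z (right_end e)) \in constraint e))%N.
Proof.
move=> lE mE; rewrite card_satisfied_restrict.
rewrite -(sum_concat_edge H1 H2 S T (fun t : W * edge G * Z =>
  ((l t.1.1 (left_end t.1.2), m t.2 (right_end t.1.2)) \in constraint t.1.2) : nat)).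
by apply: eq_bigr => t _ /=; rewrite inE /= lE mE.
Qed.

(** * Passing labels between the two games *)

(** A position exists only for a neighbour, so [l] decides membership and answers [a0] elsewhere. *)
Lemma local_labels (W X A : finType) (H : {set W * X}) (D : nat)
    (regH : left_regular H D) (a0 : A) (L : W -> D.-tuple A) :
  exists l : W -> X -> A,
    forall w x (wx : (w, x) \in H), tnth (L w) (nbr_index regH wx) = l w x.
Proof.
exists (fun w x =>
  if decP (@idP ((w, x) \in H)) is left wx then tnth (L w) (nbr_index regH wx)
  else a0).
by move=> w x wx; case: decP => // wx'; rewrite (bool_irrelevance wx wx').
Qed.

Lemma lift_labels (W X A : finType) (H : {set W * X}) (D : nat)
    (regH : left_regular H D) (L : X -> A) :
  exists l : {ffun W -> D.-tuple A},
    forall w x (wx : (w, x) \in H), tnth (l w) (nbr_index regH wx) = L x.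
Proof.
exists [ffun w =>
  [tuple L (enum_val (cast_ord (esym (regH w)) i)) | i < D]].
move=> w x wx; rewrite ffunE tnth_mktuple cast_ordK enum_rankK_in //.
by rewrite inE.
Qed.

(** * Comparing the two values *)

(** Let each [x] copy the answer of a uniform neighbour in [S], and each [y] likewise in [T]. The
    winning chance [s e] is then the satisfied fraction of the copies of [e], and its uniform mean
    is at most the value of [G]. *)
Lemma game_val_restrict_concat_le (R : realType) (X Y A B W Z : finType)
    (G : game X Y A B) (eps delta : R) (H1 : {set W * X}) (H2 : {set Z * Y})
    (D1 D2 : nat) (reg1 : left_regular H1 D1) (reg2 : left_regular H2 D2)
    (S : {set W}) (T : {set Z}) :
  biregular G -> 0 < eps ->
  fortifier delta eps eps H1 -> fortifier delta eps eps H2 ->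
  delta * #|W|%:R <= #|S|%:R -> delta * #|Z|%:R <= #|T|%:R ->
  game_val R (restrict (concat G reg1 reg2) S T) <= game_val R G + 3 * eps.
Proof.
move=> regG eps0 fort1 fort2 Sbig Tbig.
have rhs0 : 0 <= game_val R G + 3 * eps.
  by have := game_val_ge0 R G; lra.
have [E0|E0] := posnP #|edge (restrict (concat G reg1 reg2) S T)|.
  by rewrite game_val_no_edge.
apply: bigmax_le => // L _.
(* An edge of the restricted game supplies the default vertices and labels. *)
have [t _] := card_gt0P E0; case: (sval t) => -[[w0 e0] z0] /= /andP[wx zy].
have [l lE] := local_labels reg1 (tnth (L.1 w0) (nbr_index reg1 wx)) L.1.
have [m mE] := local_labels reg2 (tnth (L.2 z0) (nbr_index reg2 zy)) L.2.
rewrite (card_satisfied_restrict_concat G S T lE mE).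
move: E0; rewrite card_edge_restrict_concat => E0.
pose p x w : R := (w \in back_nbrs H1 S x)%:R / #|back_nbrs H1 S x|%:R.
pose q y z : R := (z \in back_nbrs H2 T y)%:R / #|back_nbrs H2 T y|%:R.
have p0 x w : 0 <= p x w by rewrite divr_ge0.
have q0 y z : 0 <= q y z by rewrite divr_ge0.
(* For an empty set the sum is 0, hence only a subdistribution. *)
have sub1 (V : finType) (U : {set V}) : \sum_v (v \in U)%:R / #|U|%:R <= 1 :> R.
  rewrite -mulr_suml -natr_sum -big_mkcond sum1_card.
  by have [->|U0] := posnP #|U|; rewrite ?mul0r // divff // pnatr_eq0 -lt0n.
pose s (e : edge G) : R := \sum_w \sum_z p (left_end e) w * q (right_end e) z *
    ((l w (left_end e), m z (right_end e)) \in constraint e)%:R.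
have s01 e : 0 <= s e <= 1.
  apply/andP; split.
    do 2![apply: sumr_ge0 => ? _].
    exact: mulr_ge0 (mulr_ge0 (p0 _ _) (q0 _ _)) (ler0n _ _).
  apply: (@le_trans _ _ ((\sum_w p (left_end e) w) * \sum_z q (right_end e) z)).
    rewrite mulr_suml; apply: ler_sum => w _.
    rewrite mulr_sumr; apply: ler_sum => z _.
    by rewrite (ler_piMr (mulr_ge0 (p0 _ _) (q0 _ _))) // lern1 leq_b1.
  by rewrite mulr_ile1 ?sumr_ge0 ?sub1.
have := fortified_mean_close reg1 reg2 regG fort1 fort2 Sbig Tbig s01.
rewrite /= -natr_sum ltr0n => /(_ E0); rewrite ler_norml => /andP[_].
(* The weight of [e] cancels the denominators of [p] and [q], leaving the number of satisfied
   copies. *)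
have -> : \sum_e (#|back_nbrs H1 S (left_end e)| *
                  #|back_nbrs H2 T (right_end e)|)%:R * s e =
  (\sum_(e : edge G) \sum_(w in back_nbrs H1 S (left_end e))
     \sum_(z in back_nbrs H2 T (right_end e))
       ((l w (left_end e), m z (right_end e)) \in constraint e))%:R.
  rewrite natr_sum; apply: eq_bigr => e _.
  rewrite natr_sum mulr_sumr [RHS]big_mkcond; apply: eq_bigr => w _.
  rewrite mulr_sumr; case: ifP => [wU|wU]; last first.
    by rewrite big1 // => z _; rewrite /p wU !mul0r mulr0.
  rewrite natr_sum [RHS]big_mkcond; apply: eq_bigr => z _.
  rewrite /p /q wU; case: ifP => zU; last by rewrite !(mul0r, mulr0).
  have n1 : #|back_nbrs H1 S (left_end e)|%:R != 0 :> R.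
    by rewrite pnatr_eq0 -lt0n; apply/card_gt0P; exists w.
  have n2 : #|back_nbrs H2 T (right_end e)|%:R != 0 :> R.
    by rewrite pnatr_eq0 -lt0n; apply/card_gt0P; exists z.
  by rewrite natrM /=; field; rewrite n1 n2.
have eG0 : 0 < #|edge G|%:R :> R by rewrite ltr0n; apply/card_gt0P; exists e0.
have : (\sum_e s e) / #|edge G|%:R <= game_val R G.
  by rewrite ler_pdivrMr // mulrC; apply: mixed_strategy_le => // ?; apply: sub1.
lra.
Qed.

(** A lifted labelling satisfies either all copies of an edge or none, so its value is the weighted
    mean of a 0/1 function whose uniform mean is the original value. *)
Lemma game_val_le_restrict_concat (R : realType) (X Y A B W Z : finType)
    (G : game X Y A B) (eps delta : R) (H1 : {set W * X}) (H2 : {set Z * Y})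
    (D1 D2 : nat) (reg1 : left_regular H1 D1) (reg2 : left_regular H2 D2)
    (S : {set W}) (T : {set Z}) :
  biregular G -> 0 < eps ->
  fortifier delta eps eps H1 -> fortifier delta eps eps H2 ->
  delta * #|W|%:R <= #|S|%:R -> delta * #|Z|%:R <= #|T|%:R ->
  (0 < #|edge (restrict (concat G reg1 reg2) S T)|)%N ->
  game_val R G <= game_val R (restrict (concat G reg1 reg2) S T) + 3 * eps.
Proof.
move=> regG eps0 fort1 fort2 Sbig Tbig E0.
apply: bigmax_le => [|L _].
  by have := game_val_ge0 R (restrict (concat G reg1 reg2) S T); lra.
have [l lE] := lift_labels reg1 L.1; have [m mE] := lift_labels reg2 L.2.
have := game_val_ge R (restrict (concat G reg1 reg2) S T) (l, m).
rewrite (@card_satisfied_restrict_concat _ _ _ _ _ _ G _ _ _ _ reg1 reg2 S T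
  (l, m) (fun=> L.1) (fun=> L.2)) //.
move: E0; rewrite card_edge_restrict_concat => E0.
pose s (e : edge G) : R := ((L.1 (left_end e), L.2 (right_end e)) \in constraint e)%:R.
have s01 e : 0 <= s e <= 1 by rewrite ler0n lern1 leq_b1.
have := fortified_mean_close reg1 reg2 regG fort1 fort2 Sbig Tbig s01.
rewrite /= -natr_sum ltr0n => /(_ E0); rewrite ler_norml => /andP[+ _].
rewrite card_satisfied.
under eq_bigr do rewrite -natrM.
under [in X in _ -> X -> _]eq_bigr do rewrite !sum_nat_const mulnA.
rewrite /s -!natr_sum; lra.
Qed.

Theorem mainTheorem1 (R : realType) :
  exists C : R, 0 < C /\
    forall (X Y A B W Z : finType) (G : game X Y A B) (eps delta : R)
      (H1 : {set W * X}) (H2 : {set Z * Y}) (D1 D2 : nat)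
      (reg1 : left_regular H1 D1) (reg2 : left_regular H2 D2),
      biregular G -> 0 < eps -> 0 < delta ->
      fortifier delta eps eps H1 -> fortifier delta eps eps H2 ->
      robust delta (C * eps) (concat G reg1 reg2).
Proof.
exists 6; split=> // X Y A B W Z G eps delta H1 H2 D1 D2 reg1 reg2.
move=> regG eps0 _ fort1 fort2 S T Sbig Tbig.
have [E0|E0] := posnP #|edge (restrict (concat G reg1 reg2) S T)|.
  rewrite game_val_no_edge //.
  by have := game_val_ge0 R (concat G reg1 reg2); lra.
have up := game_val_restrict_concat_le reg1 reg2 regG eps0 fort1 fort2 Sbig Tbig.
(* The full vertex sets compare [G] with the unrestricted concatenated game. *)
have := @game_val_le_restrict_concat _ _ _ _ _ _ _ _ _ _ _ _ _ _ reg1 reg2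
  [set: W] [set: Z] regG eps0 fort1 fort2.
rewrite game_val_restrict_setT !cardsT.
(* [delta] may exceed 1, so the full sets qualify only because [S] and [T] do. *)
have big (V : finType) (U : {set V}) :
    delta * #|V|%:R <= #|U|%:R -> delta * #|V|%:R <= #|V|%:R.
  by move/le_trans; apply; rewrite ler_nat max_card.
move=> /(_ (big _ _ Sbig) (big _ _ Tbig)) low.
suff /low : (0 < #|edge (restrict (concat G reg1 reg2) [set: W] [set: Z])|)%N.
  by lra.
move: E0; rewrite !card_edge_restrict => /leq_trans; apply.
by apply: sub_le_big => // *; rewrite ?leq_addr ?in_setT.
Qed.
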